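(* There exists a constant $C > 1$ and an integer $n_0$ such that for every odd $n \ge n_0$ the following holds. Let $G$ be a graph with $n$ vertices and minimum degree $\delta(G) \ge n/2 + C$. Then $\mathcal{C}_n(G) = \mathcal{C}(G)$.
   Context: Graphs are finite and simple. For a graph $G=(V,E)$, the edge space $\mathcal{E}(G)$ is the $\mathbb{F}_2$-vector space of all subsets of $E$, with addition given by symmetric difference. The cycle space $\mathcal{C}(G) \subseteq \mathcal{E}(G)$ is the subspace spanned by (the edge sets of) all, not necessarily induced, cycles in $G$. For an integer $k$, $\mathcal{C}_k(G) \subseteq \mathcal{C}(G)$ is the subspace spanned by the edge sets of all cycles in $G$ of length exactly $k$. Thus, if $G$ has $n$ vertices, $\mathcal{C}_n(G)$ is the subspace spanned by the Hamilton cycles of $G$. *)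

(* Defs.v *)
From HB Require Import structures.
From mathcomp Require Import all_boot all_order all_algebra.
From mathcomp Require Import boolp reals.

Set Implicit Arguments.
Unset Strict Implicit.
Unset Printing Implicit Defensive.

Import GRing.Theory.
Local Open Scope ring_scope.

Record sgraph := SGraph {
  vertex :> finType;
  adj : rel vertex;
  adj_sym : symmetric adj;
  adj_irrefl : irreflexive adj }.

Section Graph.
Variable G : sgraph.

Definition degree (v : G) : nat := #|[set w | adj v w]|.

(* The default value #|G| exceeds every degree, so this is the minimum of the
   degrees as soon as G has a vertex. *)
Definition min_degree : nat := \big[minn/#|G|]_(v : G) degree v.

Definition edges : {set {set G}} := [set [set x; y] | x in G, y in adj x].

Definition edge : finType := {e : {set G} | e \in edges}.

Definition is_cycle (c : seq G) : bool := (2 < size c)%N && ucycleb (@adj G) c.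

Definition edge_space : Type := {set edge}.

Definition cycle_edges (c : seq G) : edge_space :=
  [set e : edge | [exists x in c, val e == [set x; next c x]]].

End Graph.

Section EdgeSpace.
Variable G : sgraph.
Local Notation V := (edge_space G).
Implicit Types (A B : V) (a b : 'F_2).

HB.instance Definition _ := Finite.copy V {set edge G}.

Definition symdiff A B : V := (A :\: B) :|: (B :\: A).

Lemma in_symdiff A B x : (x \in symdiff A B) = (x \in A) (+) (x \in B).
Proof. by rewrite !inE; do 2 case: (_ \in _). Qed.

Fact symdiffA : associative symdiff.
Proof. by move=> A B D; apply/setP=> x; rewrite !in_symdiff addbA. Qed.

Fact symdiffC : commutative symdiff.
Proof. by move=> A B; rewrite /symdiff setUC. Qed.

Fact symdiff0 : left_id (set0 : V) symdiff.
Proof. by move=> A; rewrite /symdiff set0D setD0 set0U. Qed.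

Fact symdiffN : left_inverse (set0 : V) id symdiff.
Proof. by move=> A; rewrite /symdiff setDv setU0. Qed.

HB.instance Definition _ :=
  GRing.isZmodule.Build V symdiffA symdiffC symdiff0 symdiffN.

Definition scale_edges a A : V := if a == 0 then set0 else A.

Fact F2_cases a : a = 0 \/ a = 1.
Proof. by case: a => [[|[|m]] Hm] //; [left | right]; apply: val_inj. Qed.

Fact scale_edgesA a b A :
  scale_edges a (scale_edges b A) = scale_edges (a * b) A.
Proof. by rewrite /scale_edges mulf_eq0; do 2 case: (_ == _). Qed.

Fact scale_edges1 : left_id 1 scale_edges.
Proof. by []. Qed.

Fact scale_edgesDr : right_distributive scale_edges +%R.
Proof.
by move=> a A B; rewrite /scale_edges; case: (_ == _); rewrite ?addr0.
Qed.

Fact scale_edgesDl A : {morph scale_edges^~ A : a b / a + b}.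
Proof.
move=> a b; rewrite /scale_edges.
case: (F2_cases a) => ->; case: (F2_cases b) => -> /=.
- by rewrite (addr0 (0 : V)).
- by rewrite (add0r (A : V)).
- by rewrite (addr0 (A : V)).
- by rewrite (symdiffN A : A + A = 0).
Qed.

HB.instance Definition _ := GRing.Zmodule_isLmodule.Build 'F_2 V
  scale_edgesA scale_edges1 scale_edgesDr scale_edgesDl.

Definition edges_to_row A : 'rV['F_2]_#|edge G| :=
  \row_i (enum_val i \in A)%:R.

Fact edge_space_vect_axiom : Vector.axiom #|edge G| V.
Proof.
exists edges_to_row.
  move=> a A B; apply/rowP=> i; rewrite !mxE in_symdiff.
  case: (F2_cases a) => -> /=; rewrite ?inE /scale_edges /= ?mul0r ?mul1r ?inE.
    by rewrite add0r.
  by do 2 case: (_ \in _); apply: val_inj.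
exists (fun r : 'rV_#|edge G| => [set e : edge G | r 0 (enum_rank e) != 0]).
  move=> A; apply/setP=> e; rewrite inE mxE enum_rankK.
  by case: (_ \in _).
move=> r; apply/rowP=> i; rewrite mxE inE enum_valK.
by case: (F2_cases (r 0 i)) => ->.
Qed.

HB.instance Definition _ :=
  Lmodule_hasFinDim.Build 'F_2 V edge_space_vect_axiom.

Definition cycle_space : {vspace V} :=
  <<enum [pred A : V | `[< exists2 c : seq G, is_cycle c & A = cycle_edges c >]]>>%VS.

Definition cycle_space_of_length (k : nat) : {vspace V} :=
  <<enum [pred A : V | `[< exists c : seq G,
      [/\ is_cycle c, size c = k & A = cycle_edges c] >]]>>%VS.

End EdgeSpace.

(* Main.v *)
Require Import Defs.
From mathcomp Require Import all_boot all_order all_algebra.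
From mathcomp Require Import reals.
From mathcomp Require Import boolp zify ring lra.
Import Order.TTheory GRing.Theory Num.Theory.
Local Open Scope ring_scope.

(** By duality over F_2, it is enough to show that every additive map [phi]
from the edge space to the booleans that vanishes on all Hamilton cycles
vanishes on all cycles ([memv_separation]). Such a map is a labelling [l] of
the edges, and its value on a cycle is the sum of the labels ([weight]) along
it.

A large constant in the degree condition leaves enough room to complete every
short path to a Hamilton cycle ([path_extends_to_hamilton_cycle]): among all
ways to arrange the other vertices after the path, the one with the fewest
non-adjacent consecutive pairs has none, since otherwise reversing a segment
would give fewer. Hence two short paths with the same ends and the same
vertices have the same weight, as both can be completed by the same remainder
([weight_switch]).

An even cycle v_1 ... v_2k of bounded length yields two such paths: join v_i
to v_(2k+2-i) through a fresh common neighbour, for 2 <= i <= k; both perfect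
matchings of the cycle, together with these connections, form a path from v_1
to v_(k+1). So cycles of length 4 and 6 have weight 0. Any two vertices have
many common neighbours, and the 4-cycles say that the weight of a path u x v
depends only on u and v, while the 6-cycles say that this function of u and v
is additive, that is, of the form g(u) + g(v) ([two_step_potential]). (The
4-cycles alone do not give additivity: let V be the union of three classes of
equal size, an independent set I complete to two cliques A and B without edges
between A and B, and let the edges between I and A and those inside B have
label 1, the others 0.) It follows that
l(u, v) = g(u) + g(v) + c for a constant c: up to complement, the labelling is
a cut. The weight of a cycle is then c times its length. As the number of
vertices is odd, a Hamilton cycle gives c = 0, and all cycles have weight 0. *)

(** * Consecutive pairs of a sequence *)

Lemma pairmap_rev {T R : Type} (f : T -> T -> R) (x : T) (s : seq T) :
  (forall y z, f y z = f z y) ->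
  pairmap f (last x s) (rev (belast x s)) = rev (pairmap f x s).
Proof.
move=> fC; elim: s x => [|y s IHs] x //=.
rewrite !rev_cons -!cats1 pairmap_cat IHs /= fC; congr (_ ++ [:: f _ _]).
by case: s {IHs} => [|z s] //=; rewrite rev_cons last_rcons.
Qed.

Lemma has_pairmap {T R : Type} (P : pred R) (f : T -> T -> R) (x : T)
    (s : seq T) :
  has P (pairmap f x s) ->
  exists s1 y s2, s = s1 ++ y :: s2 /\ P (f (last x s1) y).
Proof.
elim: s x => [|y s IHs] x //= /orP[Pxy|/IHs[s1 [z [s2 [-> Pz]]]]].
  by exists [::], y, s.
by exists (y :: s1), z, s2.
Qed.

(** A pigeonhole over the [size s] consecutive pairs of [x :: s]: the pairs
whose first member satisfies [p] and those whose second member satisfies [q]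
are too many to be disjoint. *)
Lemma has_consecutive {T : Type} (p q : pred T) (x : T) (s : seq T) :
  (size s < count p (belast x s) + count q s)%N ->
  has id (pairmap (fun y z => p y && q z) x s).
Proof.
elim: s x => [|y s IHs] x //=; case: (boolP (p x && q y)) => //= pxqy lt_s.
apply: IHs; move: pxqy lt_s; case: (p x); case: (q y) => //= _; lia.
Qed.

(** * Spanning paths by reversing segments *)

Section Gaps.
Variables (T : eqType) (e : rel T).
Hypotheses (e_sym : symmetric e) (e_irr : irreflexive e).

Definition gaps (x : T) (s : seq T) : nat := count negb (pairmap e x s).

Lemma gaps_cat (x : T) (s t : seq T) :
  gaps x (s ++ t) = (gaps x s + gaps (last x s) t)%N.
Proof. by rewrite /gaps pairmap_cat count_cat. Qed.

Lemma gaps0_path (x : T) (s : seq T) : gaps x s = 0%N -> path e x s.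
Proof.
elim: s x => [|y s IHs] x //; rewrite /gaps /=.
by case: (e x y) => //= /IHs.
Qed.

(** Reversing a segment preserves the pairs inside it, because [e] is symmetric,
and replaces only the two pairs at its borders. *)
Lemma gaps_reverse_segment (x y z : T) (s t u : seq T) :
  e (last x s) (last y t) -> e y z ->
  ~~ (e (last x s) y && e (last y t) z) ->
  (gaps x (s ++ rev (y :: t) ++ z :: u) < gaps x (s ++ (y :: t) ++ z :: u))%N.
Proof.
move=> e_st e_yz gap.
have revE : rev (y :: t) = last y t :: rev (belast y t).
  by rewrite lastI rev_rcons.
have gaps_revE : gaps (last y t) (rev (belast y t)) = gaps y t.
  by rewrite /gaps pairmap_rev ?count_rev.
have last_revE : last (last y t) (rev (belast y t)) = y.
  by case: (t) => [|w t'] //=; rewrite rev_cons last_rcons.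
rewrite !gaps_cat revE /= ltn_add2l /gaps /= -!/(gaps _ _) gaps_revE.
rewrite last_revE e_st e_yz /=.
by case: (e _ y) gap; case: (e _ z) => //= _; lia.
Qed.

(** Take an arrangement with given ends and the fewest gaps. If [a], [b] is a
gap, the degree condition and [has_consecutive] give a consecutive pair [y],
[z] with [a] adjacent to [y] and [b] adjacent to [z]; reversing the segment
between the gap and this pair, whichever comes first, removes the gap and
creates none. *)
Lemma dense_hamilton_connected (x : T) (s : seq T) :
  {in x :: s, forall a, (size s + 3 <= 2 * count (e a) (x :: s))%N} ->
  exists s', [/\ perm_eq s' s, last x s' = last x s & path e x s'].
Proof.
have [n] := ubnP (gaps x s); elim: n s => // n IHn s lt_n dense.
have [/eqP/gaps0_path|] := boolP (gaps x s == 0%N); first by exists s.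
rewrite -lt0n -has_count; case/(@has_pairmap T bool) => s1 [b [s2 [sE gap]]].
set a := last x s1 in gap.
suff [s' [perm_s' last_s' lt_s']] : exists s',
    [/\ perm_eq s' s, last x s' = last x s & (gaps x s' < gaps x s)%N].
  have [||s'' [perm_s'' last_s'' path_s'']] := IHn s'; first 1 last.
  - move=> v; have perm_xs : perm_eq (x :: s') (x :: s) by rewrite perm_cons.
    rewrite (perm_mem perm_xs) (permP perm_xs) (perm_size perm_s').
    exact: dense.
  - by exists s''; rewrite (perm_trans perm_s'') // last_s''.
  - by apply: leq_trans lt_s' _; rewrite -ltnS.
have xs_a : a \in x :: s.
  by rewrite sE -cat_cons mem_cat mem_last.
have xs_b : b \in x :: s by rewrite sE inE mem_cat mem_head !orbT.
(* The first end of the path is never a second member of a pair and the last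
   end never a first member, which may cost each of the two counts one. *)
have belastE : count (e a) (x :: s) = (count (e a) (belast x s) + e a (last x s))%N.
  by rewrite lastI -cats1 count_cat /= addn0.
have : (size s < count (e a) (belast x s) + count (e b) s)%N.
  have := dense _ xs_a; have := dense _ xs_b; rewrite belastE /=.
  by case: (e a _); case: (e b _) => /=; lia.
move/(@has_consecutive T); rewrite sE pairmap_cat has_cat /= -/a e_irr /=.
(* The pair lies before the gap, or after it. *)
case/orP=> /(@has_pairmap T bool)[t1 [z [t2 [tE /andP[e_a e_b]]]]].
  exists (t1 ++ rev (z :: t2) ++ b :: s2); split.
  - rewrite tE -catA perm_cat2l perm_cat2r; exact/permPl/perm_rev.
  - by rewrite tE !last_cat.
  have aE : a = last z t2 by rewrite /a tE last_cat.
  rewrite tE -catA; apply: gaps_reverse_segment.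
  - by rewrite -aE e_sym.
  - by rewrite e_sym.
  - by rewrite -aE negb_and gap orbT.
exists (s1 ++ rev (b :: t1) ++ z :: t2); split.
- rewrite tE -cat_cons perm_cat2l perm_cat2r; exact/permPl/perm_rev.
- by rewrite tE !last_cat /= last_cat.
rewrite tE -cat_cons; apply: gaps_reverse_segment => //.
by rewrite negb_and gap.
Qed.
End Gaps.

(** * Graphs of minimum degree slightly above half the order *)

Section Dense.
Variable G : sgraph.
Hypothesis dense : forall v : G, (#|G| + 8 <= 2 * degree v)%N.

Lemma degree_count (v : G) (s : seq G) :
  uniq s -> (degree v <= count (adj v) s + (#|G| - size s))%N.
Proof.
move=> s_uniq; rewrite /degree -(cardsID [set w in s]).
apply: leq_add.
  rewrite -size_filter -(card_uniqP (filter_uniq _ s_uniq)).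
  by apply/subset_leq_card/subsetP=> w; rewrite !inE mem_filter.
rewrite -(card_uniqP s_uniq) -(cardC (mem s)) addKn.
by apply/subset_leq_card/subsetP=> w; rewrite !inE => /andP[].
Qed.

Lemma common_neighbour (u v : G) (s : seq G) :
  (size s < 8)%N -> exists2 x, x \notin s & adj u x && adj v x.
Proof.
move=> lt_s.
suff /card_gt0P[x] :
    (0 < #|[set w | adj u w] :&: [set w | adj v w] :\: [set w in s]|)%N.
  by rewrite !inE => /andP[x_s x_uv]; exists x.
have := cardsUI [set w | adj u w] [set w | adj v w].
have := max_card ([set w | adj u w] :|: [set w | adj v w]).
have := subset_leq_card
  (subsetIr ([set w | adj u w] :&: [set w | adj v w]) [set w in s]).
have : (#|[set w in s]| <= size s)%N by rewrite cardsE card_size.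
have := dense u; have := dense v; rewrite cardsD /degree.
lia.
Qed.

Lemma dense_card_gt2 (v : G) : (2 < #|G|)%N.
Proof.
have := dense v; have : (degree v <= #|G|)%N by exact: max_card.
by lia.
Qed.

(** The inner vertices of the path are removed, and what remains is dense enough
to be traversed from one end of the path to the other. This loses
[(size p).-1] in the degrees and as much in the number of vertices, so an
excess of 8 allows for 7 edges, the length of the paths that show that 6-cycles
have weight 0. *)
Lemma path_extends_to_hamilton_cycle (a : G) (p : seq G) :
  path (@adj G) a p -> uniq (a :: p) -> (0 < size p <= 7)%N ->
  exists q, [/\ path (@adj G) (last a p) (rcons q a), uniq (a :: p ++ q)
              & size (a :: p ++ q) = #|G|].
Proof.
move=> ap_path ap_uniq /andP[p_gt0 p_le7].
set r := enum [predC a :: p].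
have r_size : (size r + (size p).+1)%N = #|G|.
  by rewrite -cardE -(cardC (mem (a :: p))) (card_uniqP ap_uniq) addnC.
have apr_uniq : uniq (a :: p ++ r).
  rewrite -cat_cons cat_uniq ap_uniq enum_uniq andbT /=.
  by apply/hasPn=> w; rewrite mem_enum.
set b := last a p.
have b_p : b \in p by rewrite /b; case: (p) p_gt0 => // w p' _; rewrite /= mem_last.
have t_uniq : uniq (b :: rcons r a).
  move: apr_uniq; rewrite /= mem_cat negb_or cat_uniq rcons_uniq mem_rcons in_cons.
  case/andP=> /andP[a_p a_r] /and3P[_ /hasPn p_r ->]; rewrite a_r negb_or !andbT.
  rewrite (contraNneq _ a_p) => [|<- //] /=.
  by apply: contraTN b_p => /p_r.
have t_dense : {in b :: rcons r a, forall v,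
    (size (rcons r a) + 3 <= 2 * count (adj v) (b :: rcons r a))%N}.
  move=> v _; have := degree_count v _ t_uniq; have := dense v.
  rewrite [size (b :: _)]/= size_rcons; move: p_gt0 p_le7 r_size; lia.
have [s [perm_s last_s s_path]] :=
  dense_hamilton_connected _ _ (@adj_sym G) (@adj_irrefl G) _ _ t_dense.
case/lastP: s perm_s last_s s_path => [/perm_size|q w]; first by rewrite size_rcons.
rewrite !last_rcons => /[swap] -> perm_q q_path.
have {}perm_q : perm_eq q r.
  by rewrite -(perm_cons a) -perm_rcons (perm_trans perm_q) // perm_rcons.
exists q; split=> //; last by rewrite /= size_cat (perm_size perm_q) -r_size addnS addnC.
rewrite -cat_cons (perm_uniq (_ : perm_eq _ ((a :: p) ++ r))) //.
by rewrite perm_cat2l.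
Qed.
End Dense.

(** * Edge labellings of weight zero on Hamilton cycles *)

Section Weight.
Context {T : Type}.
Variable l : T -> T -> bool.

Definition weight (x : T) (s : seq T) : bool :=
  \big[addb/false]_(b <- pairmap l x s) b.

Lemma weight_nil (x : T) : weight x [::] = false.
Proof. exact: big_nil. Qed.

Lemma weight_cons (x y : T) (s : seq T) :
  weight x (y :: s) = l x y (+) weight y s.
Proof. exact: big_cons. Qed.

Lemma weight_cat (x : T) (s t : seq T) :
  weight x (s ++ t) = weight x s (+) weight (last x s) t.
Proof. by rewrite /weight pairmap_cat big_cat. Qed.

End Weight.

Section Labelling.
Variables (G : sgraph) (l : G -> G -> bool).
Hypothesis dense : forall v : G, (#|G| + 8 <= 2 * degree v)%N.
Hypothesis l_sym : forall x y, l x y = l y x.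
Hypothesis hamilton0 : forall (x : G) (s : seq G),
  is_cycle (x :: s) -> size (x :: s) = #|G| -> weight l x (rcons s x) = false.

(** One and the same remainder completes both paths to Hamilton cycles. *)
Lemma weight_switch (a : G) (p p' : seq G) :
  path (@adj G) a p -> path (@adj G) a p' -> uniq (a :: p) -> perm_eq p p' ->
  last a p = last a p' -> (0 < size p <= 7)%N -> weight l a p = weight l a p'.
Proof.
move=> p_path p'_path p_uniq perm_p last_p p_size.
have [q [q_path pq_uniq pq_size]] :=
  path_extends_to_hamilton_cycle _ dense _ _ p_path p_uniq p_size.
suff sum0 r : path (@adj G) a r -> perm_eq p r -> last a p = last a r ->
    weight l a r (+) weight l (last a p) (rcons q a) = false.
  have := sum0 p p_path (perm_refl _) erefl.
  have := sum0 p' p'_path perm_p last_p.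
  by do 2 case: weight; case: weight.
move=> r_path perm_r last_r; rewrite {1}last_r -weight_cat -rcons_cat.
have perm_pq : perm_eq (a :: p ++ q) (a :: r ++ q).
  by rewrite perm_cons perm_cat2r.
apply: hamilton0; last by rewrite -(perm_size perm_pq).
rewrite /is_cycle -(perm_size perm_pq) pq_size (dense_card_gt2 _ dense a) /= /ucycleb.
rewrite -(perm_uniq perm_pq) pq_uniq andbT /=.
by rewrite rcons_cat cat_path r_path -last_r.
Qed.

(** The switching paths are a b x d c and a d x b c. *)
Lemma weight_4cycle (a b c d : G) :
  uniq [:: a; b; c; d] -> cycle (@adj G) [:: a; b; c; d] ->
  weight l a [:: b; c; d; a] = false.
Proof.
move=> abcd_uniq /= /and5P[ab bc cd da _].
have [x x_abcd /andP[bx dx]] := common_neighbour _ dense b d [:: a; b; c; d] isT.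
have : weight l a [:: b; x; d; c] = weight l a [:: d; x; b; c].
  apply: weight_switch => //.
  - by rewrite /= ab bx adj_sym dx adj_sym cd.
  - by rewrite /= adj_sym da dx adj_sym bx bc.
  - rewrite -(perm_uniq (_ : perm_eq (x :: [:: a; b; c; d]) _)).
      by rewrite cons_uniq x_abcd.
    by apply/permP=> P /=; ring.
  - by apply/permP=> P /=; ring.
rewrite !weight_cons !weight_nil (l_sym x b) (l_sym x d) (l_sym d c) (l_sym a d).
by do 6 case: (l _ _).
Qed.

(** The switching paths are a b x f e y c d and a f x b c y e d. *)
Lemma weight_6cycle (a b c d e f : G) :
  uniq [:: a; b; c; d; e; f] -> cycle (@adj G) [:: a; b; c; d; e; f] ->
  weight l a [:: b; c; d; e; f; a] = false.
Proof.
move=> abcdef_uniq /= /and5P[ab bc cd de /and3P[ef fa _]].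
have [x x_new /andP[bx fx]] :=
  common_neighbour _ dense b f [:: a; b; c; d; e; f] isT.
have [y y_new /andP[cy ey]] :=
  common_neighbour _ dense c e [:: x; a; b; c; d; e; f] isT.
have : weight l a [:: b; x; f; e; y; c; d] = weight l a [:: f; x; b; c; y; e; d].
  apply: weight_switch => //.
  - by rewrite /= ab bx adj_sym fx adj_sym ef ey adj_sym cy cd.
  - by rewrite /= adj_sym fa fx adj_sym bx bc cy adj_sym ey adj_sym de.
  - rewrite -(perm_uniq (_ : perm_eq (y :: x :: [:: a; b; c; d; e; f]) _)).
      by rewrite !cons_uniq y_new x_new.
    by apply/permP=> P /=; ring.
  - by apply/permP=> P /=; ring.
rewrite !weight_cons !weight_nil (l_sym x b) (l_sym x f) (l_sym f e) (l_sym a f).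
rewrite (l_sym y c) (l_sym y e) (l_sym e d).
by do 10 case: (l _ _).
Qed.

(** If the four vertices are distinct, [u x v y] is a 4-cycle. *)
Lemma two_step_unique (u v x y : G) :
  adj u x -> adj x v -> adj u y -> adj y v ->
  l u x (+) l x v = l u y (+) l y v.
Proof.
move=> ux xv uy yv.
have [->|uv] := eqVneq u v; first by rewrite !(l_sym v) !addbb.
have [->//|xy] := eqVneq x y.
have : weight l u [:: x; v; y; u] = false.
  apply: weight_4cycle; last by rewrite /= ux xv (adj_sym v) yv adj_sym uy.
  have adjNeq (w z : G) : adj w z -> w != z.
    by move=> wz; apply: contraTneq wz => ->; rewrite adj_irrefl.
  rewrite /= !inE !negb_or uv xy !adjNeq //= 1?adj_sym //.
rewrite !weight_cons weight_nil (l_sym v) (l_sym y u).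
by do 4 case: (l _ _).
Qed.

Lemma two_step (u v : G) : exists h, forall x, adj u x -> adj x v ->
  l u x (+) l x v = h.
Proof.
have [x _ /andP[ux vx]] := common_neighbour _ dense u v [::] isT.
exists (l u x (+) l x v) => y uy yv.
by apply: two_step_unique; rewrite // adj_sym.
Qed.

(** Fix a root [r] and let [g v] be the weight of any path of length two from
[r] to [v]. In the generic case the identity is the vanishing of the weight of
a 6-cycle through [r], [u] and [v]; the middle vertices can be chosen afresh
because the weight of a path of length two does not depend on them. *)
Lemma two_step_potential (r : G) : exists g : G -> bool,
  forall u x v, adj u x -> adj x v -> l u x (+) l x v = g u (+) g v.
Proof.
have [g gE] := choice (two_step r); exists g => u x v ux xv.
have [->|uv] := eqVneq u v; first by rewrite l_sym !addbb.
have gr : g r = false.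
  have [w _ /andP[rw _]] := common_neighbour _ dense r r [::] isT.
  by rewrite -(gE r w) ?(adj_sym w) // (l_sym w) addbb.
have [ur|ur] := eqVneq u r.
  by rewrite ur gr -(gE v x) // -ur.
have [vr|vr] := eqVneq v r.
  rewrite vr gr addbF -(gE u x) -?vr ?(adj_sym v) ?(adj_sym x u) //.
  by rewrite addbC (l_sym u) (l_sym v).
have [y y_new /andP[uy vy]] := common_neighbour _ dense u v [:: r; u; v] isT.
rewrite (two_step_unique u v x y) ?(adj_sym y) //.
have [w w_new /andP[rw uw]] := common_neighbour _ dense r u [:: y; r; u; v] isT.
have [z z_new /andP[rz vz]] := common_neighbour _ dense r v [:: w; y; r; u; v] isT.
have : weight l r [:: w; u; y; v; z; r] = false.
  apply: weight_6cycle.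
    rewrite -(perm_uniq (_ : perm_eq [:: z; w; y; r; u; v] _)).
      rewrite cons_uniq z_new cons_uniq w_new cons_uniq y_new /= !inE !negb_or.
      by rewrite uv !(eq_sym r) ur vr.
    by apply/permP=> P /=; ring.
  by rewrite /= rw (adj_sym w) uw uy (adj_sym y) vy vz (adj_sym z) rz.
rewrite !weight_cons weight_nil -(gE u w) ?(adj_sym w) // -(gE v z) ?(adj_sym z) //.
rewrite (l_sym v z) (l_sym z r).
by do 6 case: (l _ _).
Qed.

(** By [two_step_potential], [l u v (+) g u (+) g v] agrees on edges that share a
vertex, and any two edges are linked by a path through a common neighbour. *)
Lemma label_is_cut_or_complement (r : G) : exists (g : G -> bool) (c : bool),
  forall u v, adj u v -> l u v = g u (+) g v (+) c.
Proof.
have [g gE] := two_step_potential r.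
have [s _ /andP[rs _]] := common_neighbour _ dense r r [::] isT.
exists g, (l r s (+) g r (+) g s) => u v uv.
have [x _ /andP[sx ux]] := common_neighbour _ dense s u [::] isT.
have := gE r s x rs sx.
have := gE s x u sx; rewrite adj_sym => /(_ ux).
have := gE x u v; rewrite adj_sym => /(_ ux uv).
move: (l u v) (l x u) (l s x) (l r s) (g u) (g v) (g x) (g s) (g r).
by do 9 case.
Qed.

Lemma weight_cut (g : G -> bool) (c : bool) (x : G) (s : seq G) :
  (forall u v, adj u v -> l u v = g u (+) g v (+) c) -> path (@adj G) x s ->
  weight l x s = g x (+) g (last x s) (+) (c && odd (size s)).
Proof.
move=> lE; elim: s x => [|y s IHs] x /=.
  by rewrite weight_nil addbb andbF.
case/andP=> xy /IHs s_weight; rewrite weight_cons s_weight lE //.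
by case: c {lE IHs s_weight}; case: (odd _); case: (g x); case: (g y); case: (g _).
Qed.

(** On a closed walk the contributions of [g] cancel, leaving [c] times the
length; a Hamilton cycle has weight zero and odd length, so [c] is zero. *)
Lemma weight_cycle0 (x : G) (s : seq G) :
  odd #|G| -> is_cycle (x :: s) -> weight l x (rcons s x) = false.
Proof.
move=> G_odd /andP[_ /andP[s_path _]].
have [g [c lE]] := label_is_cut_or_complement x.
rewrite (weight_cut _ _ _ _ lE s_path) last_rcons addbb.
suff -> : c = false by [].
have [y _ /andP[xy _]] := common_neighbour _ dense x x [::] isT.
have [|||q [q_path q_uniq q_size]] := path_extends_to_hamilton_cycle _ dense x [:: y].
- by rewrite /= xy.
- by rewrite /= inE andbT; apply: contraTneq xy => ->; rewrite adj_irrefl.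
- by [].
have yq_path : path (@adj G) x (rcons (y :: q) x) by rewrite /= xy.
have q_cycle : is_cycle (x :: y :: q).
  rewrite /is_cycle /ucycleb q_uniq andbT q_size.
  by rewrite (dense_card_gt2 _ dense x) /= xy.
have := hamilton0 _ _ q_cycle q_size.
rewrite (weight_cut _ _ _ _ lE yq_path) last_rcons addbb size_rcons.
by rewrite -[_.+1]/(size (x :: y :: q)) q_size G_odd andbT.
Qed.

End Labelling.

(** * Cycles as vectors of the edge space *)

Lemma big_addb_has {T : eqType} (P : pred T) (s : seq T) :
  uniq s -> {in s &, forall x y, P x -> P y -> x = y} ->
  \big[addb/false]_(x <- s) P x = has P s.
Proof.
elim: s => [|x s IHs] /=; first by rewrite big_nil.
case/andP=> x_s s_uniq P_inj; rewrite big_cons IHs //; last first.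
  by move=> y z ys zs; apply: P_inj; rewrite in_cons ?ys ?zs orbT.
have [Px|] := boolP (P x); last by [].
rewrite /= (_ : has P s = false) //; apply/hasPn=> y ys.
apply: contra x_s => Py.
by rewrite (P_inj x y) ?mem_head ?in_cons ?ys ?orbT.
Qed.

Section CycleEdges.
Variable G : sgraph.

Definition edge_between (x y : G) : edge_space G :=
  [set e : edge G | val e == [set x; y]].

Lemma edge_between_sym (x y : G) : edge_between x y = edge_between y x.
Proof. by rewrite /edge_between setUC. Qed.

(** In a closed walk of length 2 both steps use the same edge; from length 3 on,
all steps of a cycle use different edges. *)
Lemma next2_neq (c : seq G) (x : G) :
  uniq c -> (2 < size c)%N -> x \in c -> next c (next c x) != x.
Proof.
move=> c_uniq c_gt2 xc; have [i c' rotE] := rot_to xc.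
rewrite -!(next_rot i c_uniq) rotE.
have : uniq (x :: c') by rewrite -rotE rot_uniq.
have : (2 < size (x :: c'))%N by rewrite -rotE size_rot.
case: c' {rotE} => [|y [|z c']] //= _; rewrite !inE !negb_or eqxx.
case/andP=> /and3P[xy xz _] _.
by rewrite [y == x]eq_sym (negPf xy) eqxx eq_sym.
Qed.

Lemma set2_next_inj (c : seq G) :
  uniq c -> (2 < size c)%N ->
  {in c &, injective (fun x => [set x; next c x])}.
Proof.
move=> c_uniq c_gt2 x y xc yc /= /setP eq_xy.
have := eq_xy x; rewrite !inE eqxx /= => /esym/orP[/eqP//|/eqP x_next].
have := eq_xy y; rewrite !inE eqxx /= => /orP[/eqP//|/eqP y_next].
by have := next2_neq _ _ c_uniq c_gt2 xc; rewrite -y_next -x_next eqxx.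
Qed.

Lemma cycle_edges_sum (c : seq G) : is_cycle c ->
  cycle_edges c = \sum_(x <- c) edge_between x (next c x).
Proof.
case/andP=> c_gt2 /andP[_ c_uniq]; apply/setP=> e.
rewrite inE (big_morph (fun A : edge_space G => e \in A)
  (id1 := false) (op1 := addb)); first last.
- by rewrite inE.
- by move=> A B; exact: in_symdiff.
under eq_bigr do rewrite inE.
rewrite big_addb_has //.
  by apply/existsP/hasP=> [[x /andP[]]|[x]]; exists x => //; apply/andP.
move=> x y xc yc /eqP ex /eqP ey.
by apply: (set2_next_inj _ c_uniq c_gt2) => //=; rewrite -ex.
Qed.

Lemma cycle_edges_weight (phi : edge_space G -> bool) (x : G) (s : seq G) :
  phi 0 = false -> {morph phi : A B / A + B >-> A (+) B} ->
  is_cycle (x :: s) ->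
  phi (cycle_edges (x :: s)) =
    weight (fun y z => phi (edge_between y z)) x (rcons s x).
Proof.
move=> phi0 phiD xs_cycle; rewrite cycle_edges_sum // (big_morph phi phiD phi0).
have /andP[_ /andP[_ xs_uniq]] := xs_cycle.
rewrite /weight.
rewrite -[LHS](big_map (fun y => phi (edge_between y (next _ y))) predT id).
congr bigop; apply: (@eq_from_nth _ false).
  by rewrite size_map size_pairmap size_rcons.
move=> i; rewrite size_map => lt_i.
rewrite (nth_map x) // (nth_pairmap x) ?size_rcons // -rcons_cons nth_rcons lt_i.
rewrite next_nth mem_nth // index_uniq // nth_rcons.
(* The last step returns to [x], which is also the default value of [next]. *)
case: ltnP => // le_i; rewrite (nth_default _ le_i).
by have -> : i == size s by rewrite eqn_leq le_i andbT -ltnS.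
Qed.

(** Modulo [U], the vector [A] is represented by [A - projv U A]; the functionals
that separate it from zero are the coordinates of this difference. *)
Lemma memv_separation (U : {vspace edge_space G}) (A : edge_space G) :
  (forall phi : edge_space G -> bool, phi 0 = false ->
    {morph phi : B D / B + D >-> B (+) D} -> {in U, forall B, phi B = false} ->
    phi A = false) -> A \in U.
Proof.
move=> sep; suff <- : projv U A = A by exact: memv_proj.
apply: esym; apply: subr0_eq.
apply/setP=> e; rewrite in_set0.
apply: (sep (fun B => e \in B - projv U B)) => [|B D|B BU].
- by rewrite linear0 subr0 in_set0.
- by rewrite linearD opprD addrACA; exact: in_symdiff.
- by rewrite projv_id // subrr in_set0.
Qed.

End CycleEdges.

Lemma min_degree_le (G : sgraph) (v : G) : (min_degree G <= degree v)%N.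
Proof.
rewrite /min_degree; elim: (index_enum _) (mem_index_enum v) => //= x s IHs.
rewrite inE big_cons => /orP[/eqP <-|/IHs]; first exact: geq_minl.
by apply: leq_trans; exact: geq_minr.
Qed.

(** * The theorem *)

Lemma hamilton_cycles_span_cycle_space (G : sgraph) :
  odd #|G| -> (forall v : G, (#|G| + 8 <= 2 * degree v)%N) ->
  cycle_space_of_length G #|G| = cycle_space G.
Proof.
move=> G_odd dense; apply/eqP; rewrite eqEsubv; apply/andP; split.
  apply: sub_span => A; rewrite !mem_enum !inE => /asboolP[c [c_cycle _ AE]].
  by apply/asboolP; exists c.
apply/span_subvP=> A; rewrite mem_enum inE => /asboolP[[|x s] // xs_cycle ->].
apply: memv_separation => phi phi0 phiD phiU.
rewrite cycle_edges_weight //; apply: weight_cycle0 => //.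
  by move=> y z; rewrite edge_between_sym.
move=> y t yt_cycle yt_size; rewrite -cycle_edges_weight //.
apply: phiU; apply: memv_span; rewrite mem_enum inE; apply/asboolP.
by exists (y :: t).
Qed.

Theorem theorem1p1 (R : realType) :
  exists (C : R) (n0 : nat), 1 < C /\
    forall n : nat, odd n -> (n0 <= n)%N ->
    forall G : sgraph, #|G| = n ->
      n%:R / 2 + C <= (min_degree G)%:R ->
      cycle_space_of_length G n = cycle_space G.
Proof.
(* An excess of 4 over half the order is an excess of 8 for twice the degree. *)
exists 4, 0; split; first by lra.
move=> n n_odd _ G cardG; rewrite -{n}cardG in n_odd * => dense.
apply: hamilton_cycles_span_cycle_space => // v.
have le_v : (min_degree G)%:R <= (degree v)%:R :> R by rewrite ler_nat min_degree_le.
by rewrite -(ler_nat R) natrD natrM; lra.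
Qed.
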